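(* Let $f:\mathbb{R}^2\to\mathbb{R}^2$ be a continuous periodic map for which there exist $2\times 2$ matrices $A_1,A_2$ with integer entries such that $f(v)=A_1v$ for every $v=(x,y)^t$ with $x\ge 0$, and $f(v)=A_2v$ for every $v=(x,y)^t$ with $x<0$. Then the period of $f$ is one of $1,2,3,4,5,6,7,8,9,12$.
   Context: A map $f:\mathbb{R}^2\to\mathbb{R}^2$ is periodic if $f^n=\mathrm{id}$ for some integer $n\ge 1$, where $f^n$ denotes the $n$-fold composition of $f$ with itself; its period (also called its order) is the least such $n$. *)

(* Defs.v *)
From HB Require Import structures.
From mathcomp Require Import all_boot all_order all_algebra.
From mathcomp Require Import all_classical all_reals all_analysis.

Set Implicit Arguments.
Unset Strict Implicit.
Unset Printing Implicit Defensive.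

Import Order.TTheory GRing.Theory Num.Theory.
Import numFieldNormedType.Exports.

Local Open Scope ring_scope.

Definition periodic_map (T : Type) (f : T -> T) : Prop :=
  exists n : nat, (1 <= n)%N /\ iter n f =1 id.

Definition is_least_period (T : Type) (f : T -> T) (p : nat) : Prop :=
  [/\ (1 <= p)%N, iter p f =1 id
    & forall n : nat, (1 <= n)%N -> iter n f =1 id -> (p <= n)%N].

(* Vectors (x, y)^t are columns indexed by 'I_2, so x is the entry v 0 0. *)
Definition piecewise_by (R : realType) (f : 'cV[R]_2 -> 'cV[R]_2)
    (A1 A2 : 'M[int]_2) : Prop :=
  (forall v : 'cV[R]_2, 0 <= v 0 0 -> f v = map_mx intr A1 *m v) /\
  (forall v : 'cV[R]_2, v 0 0 < 0 -> f v = map_mx intr A2 *m v).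

(* Main.v *)
Require Import Defs.
From HB Require Import structures.
From mathcomp Require Import all_boot all_order all_algebra.
From mathcomp Require Import all_classical all_reals all_analysis.
From mathcomp Require Import zify ring.

Set Implicit Arguments.
Unset Strict Implicit.
Unset Printing Implicit Defensive.

Import Order.TTheory GRing.Theory Num.Theory.
Import numFieldNormedType.Exports.

Local Open Scope ring_scope.

(** Continuity forces the two matrices to share their second column, so that
    f (x, y) = (a(x) x + b y, c(x) x + d y) with a, c depending only on the
    sign of x.

    If b = 0, the map preserves the vertical fibration; periodicity makes both
    a(x) and d a fixed sign, so f o f translates each vertical line, and a
    periodic translation is trivial (planar_pl_fibered).

    If b is not 0, passing to the coordinates (x, first coordinate of f) turns f
    into the second-order recurrence x_(n+2) = t(x_(n+1)) x_(n+1) - D(x_n) x_n,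
    where t and D are the trace and the determinant of the matrix in force
    (planar_pl_recur). This recurrence preserves integer pairs. A periodic map is
    onto, so the piecewise linear function D(x) x takes the values 1 and -1 at
    integers, whence D is constant, equal to 1 or to -1 (recur_det_unit).
    - If D = -1, any nonzero slope yields a cone of escaping orbits, so t = 0 and
      the map has order 2 (recur_reversing).
    - If D = 1, explicit cones of escaping orbits exclude all but finitely many
      pairs of slopes (slope_le1, slopes_prod_le3, slope_geN1 and
      recur_preserving). For each pair which is left, the plane splits into
      finitely many integral cones along whose orbits the map stays linear, so
      that periodicity reduces to a computation on the generators
      (fixes_planeP, recur_preserving_order).

    Altogether f^P = id for some P among 2, ..., 9, 12. The least period divides
    P, and every divisor of these numbers is in the list of the theorem. *)

(** * Iteration *)

Lemma iter_semiconj (S T : Type) (f : S -> S) (g : T -> T) (h : S -> T) :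
  (forall u, h (f u) = g (h u)) -> forall n u, h (iter n f u) = iter n g (h u).
Proof. by move=> hf; elim=> [|n IHn] u //=; rewrite hf IHn. Qed.

Lemma iter_id_surj (S T : Type) (f : S -> S) (g : T -> T) (h : S -> T)
    (h' : T -> S) n :
  cancel h' h -> (forall u, h (f u) = g (h u)) ->
  iter n f =1 id -> iter n g =1 id.
Proof. by move=> hK hf fn u; rewrite -[u]hK -(iter_semiconj hf) fn. Qed.

Lemma iter_id_inj (S T : Type) (f : S -> S) (g : T -> T) (h : S -> T) n :
  injective h -> (forall u, h (f u) = g (h u)) ->
  iter n g =1 id -> iter n f =1 id.
Proof. by move=> h_inj hf gn u; apply: h_inj; rewrite (iter_semiconj hf) gn. Qed.

(** The least period divides P because otherwise the remainder of P would be a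
    smaller period. *)
Lemma least_period_dvd (T : Type) (f : T -> T) (P : nat) :
  (0 < P)%N -> iter P f =1 id ->
  exists p, is_least_period f p /\ (p %| P)%N.
Proof.
move=> P0 fP.
have exP : exists n, (0 < n)%N && `[< iter n f =1 id >].
  by exists P; rewrite P0; apply/asboolP.
case: (ex_minnP exP) => p /andP[p0 /asboolP fp] pmin.
exists p; split.
  by split=> // n n0 fn; apply: pmin; rewrite n0; apply/asboolP.
have fr : iter (P %% p)%N f =1 id.
  move=> x; rewrite -[RHS]fP {2}(divn_eq P p) addnC iterD; congr iter.
  by elim: (P %/ p)%N => [//|k IHk]; rewrite mulSn iterD -IHk fp.
rewrite /dvdn; apply: contraT; rewrite -lt0n => r0.
have := pmin (P %% p)%N; rewrite r0 leqNgt ltn_mod p0.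
by move=> /(_ (introT (asboolP _) fr)).
Qed.

(** The integer height phi grows without bound along an orbit that stays in A,
    whereas a periodic orbit is bounded. This excludes all the non-periodic
    slopes below. *)
Lemma no_escape (T : Type) (g : T -> T) (A : T -> Prop) (phi : T -> int) (w : T) :
  periodic_map g ->
  (forall u, A u -> A (g u) /\ phi u < phi (g u)) -> ~ A w.
Proof.
move=> [n [n0 gn]] Ag Aw.
have H : forall k, A (iter k g w) /\ phi w + k%:Z <= phi (iter k g w).
  elim=> [|k [Ak phik]] /=; first by rewrite addr0.
  have [? ?] := Ag _ Ak; split=> //; lia.
have [_] := H n; rewrite gn; lia.
Qed.

Lemma periodic_iter (T : Type) (f : T -> T) (k : nat) :
  periodic_map f -> periodic_map (iter k f).
Proof.
move=> [n [n0 fn]]; exists n; split=> // x; rewrite -iterM mulnC.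
by elim: k => [//|k IHk]; rewrite mulSn iterD IHk fn.
Qed.

(** * Piecewise linear functions of one variable *)

Definition pl (R : realDomainType) (a b : int) (x : R) : R :=
  (if 0 <= x then a else b)%:~R * x.

Lemma pl_const (R : realDomainType) (a : int) (x : R) : pl a a x = a%:~R * x.
Proof. by rewrite /pl if_same. Qed.

Lemma pl0 (R : realDomainType) (a b : int) : pl a b (0 : R) = 0.
Proof. exact: mulr0. Qed.

Lemma pl_opp (R : realDomainType) (a b : int) (x : R) :
  pl a b (- x) = - pl b a x.
Proof.
by rewrite /pl oppr_ge0; case: ltgtP => [||->]; rewrite ?mulrN ?mulr0 ?oppr0.
Qed.

Lemma pl_ge0 (R : realDomainType) (a b : int) (x : R) :
  0 <= x -> pl a b x = a%:~R * x.
Proof. by rewrite /pl => ->. Qed.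

Lemma pl_le0 (R : realDomainType) (a b : int) (x : R) :
  x <= 0 -> pl a b x = b%:~R * x.
Proof. by move=> x0; rewrite -[x]opprK pl_opp pl_ge0 ?oppr_ge0 // !mulrN. Qed.

Lemma pl_intr (R : realDomainType) (a b x : int) :
  pl a b (x%:~R : R) = (pl a b x)%:~R.
Proof. by rewrite /pl ler0z intrM intz. Qed.

(** Over the integers the factors of 1 and -1 are units. As pl a b is linear on each
    half-line, x and y have opposite signs, so both slopes are seen. *)
Lemma pl_unit (a b x y : int) : pl a b x = 1 -> pl a b y = -1 ->
  a = b /\ (a = 1 \/ a = -1).
Proof.
have unit_mul (m u v : int) : m * u = v -> v = 1 \/ v = -1 ->
    m = v /\ u = 1 \/ m = - v /\ u = -1.
  move=> mu v1.
  have /eqP : (`|m| * `|u|)%N = 1%N by rewrite -abszM mu; lia.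
  rewrite muln_eq1 => /andP[/eqP m1 /eqP u1].
  have [?|?] : m = 1 \/ m = -1 by lia.
    by subst m; lia.
  by subst m; lia.
rewrite /pl !intz => /unit_mul ax /unit_mul ay.
move: (ax (or_introl erefl)) (ay (or_intror erefl)) => {ax ay}.
by case: (lerP 0 x) => x0; case: (lerP 0 y) => y0; lia.
Qed.

Lemma periodic_pl (R : realDomainType) (a b : int) :
  periodic_map (@pl R a b) -> a = b /\ (a = 1 \/ a = -1).
Proof.
move=> [[|n] [// _ plR]].
have plZ : iter n.+1 (@pl int a b) =1 id.
  apply: (iter_id_inj (h := intr)) plR; first exact: intr_inj.
  by move=> x; rewrite pl_intr.
exact: pl_unit (plZ 1) (plZ (-1)).
Qed.

(** * The associated planar recurrence *)

(** The phase map of x_(n+2) = pl t1 t2 x_(n+1) - pl d1 d2 x_n. *)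
Definition recur (R : realDomainType) (t1 t2 d1 d2 : int) (w : R * R) : R * R :=
  (w.2, pl t1 t2 w.2 - pl d1 d2 w.1).

(** With integral slopes, integer pairs form an invariant subset: periodicity over
    R becomes an arithmetic condition. *)
Lemma periodic_recur_int (R : realDomainType) t1 t2 d1 d2 :
  periodic_map (@recur R t1 t2 d1 d2) -> periodic_map (@recur int t1 t2 d1 d2).
Proof.
move=> [n [n0 Tn]]; exists n; split=> //.
apply: (iter_id_inj (h := fun w => (w.1%:~R, w.2%:~R))) Tn.
  by move=> [x y] [z t] [/intr_inj -> /intr_inj ->].
by move=> w; rewrite /recur /= !pl_intr rmorphB.
Qed.

Lemma recur_opp (R : realDomainType) t1 t2 d1 d2 (w : R * R) :
  - recur t1 t2 d1 d2 w = recur t2 t1 d2 d1 (- w).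
Proof.
case: w => x y; rewrite /recur /= !pl_opp; congr pair.
by rewrite /= opprB opprK addrC.
Qed.

Lemma iter_recur_swap (R : realDomainType) t1 t2 d1 d2 n :
  iter n (@recur R t1 t2 d1 d2) =1 id -> iter n (@recur R t2 t1 d2 d1) =1 id.
Proof. exact: iter_id_surj opprK (@recur_opp R _ _ _ _). Qed.

(** The preimages of (0, -1) and (0, 1), which are integral because the inverse is
    an iterate, have the form (x, 0) with pl d1 d2 x = 1, respectively -1. *)
Lemma recur_det_unit t1 t2 d1 d2 : periodic_map (@recur int t1 t2 d1 d2) ->
  d1 = d2 /\ (d1 = 1 \/ d1 = -1).
Proof.
move=> [[|n] [// n0 Tn]].
have [x] : exists x, pl d1 d2 (x : int) = 1.
  have := Tn (0, -1); rewrite iterS /recur; case: (iter n _ _) => x y [-> /=].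
  rewrite pl0 sub0r => xE; exists x; exact: oppr_inj.
have [y] : exists x, pl d1 d2 (x : int) = -1.
  have := Tn (0, 1); rewrite iterS /recur; case: (iter n _ _) => u v [-> /=].
  rewrite pl0 sub0r => uE; exists u; apply: oppr_inj; rewrite opprK; exact: uE.
by move=> Hy Hx; exact: pl_unit Hx Hy.
Qed.

(** * Orientation-reversing recurrences *)

(** A positive slope makes the orbit of (1, 1), or of (-1, -1), grow as
    x_(n+2) >= x_(n+1) + x_n in absolute value. With slopes <= 0, an orbit that
    starts with alternating signs keeps them without losing size, and two steps
    spread consecutive terms further apart unless both slopes vanish. *)
Lemma recur_reversing t1 t2 : periodic_map (@recur int t1 t2 (-1) (-1)) ->
  t1 = 0 /\ t2 = 0.
Proof.
have le0 s1 s2 : periodic_map (@recur int s1 s2 (-1) (-1)) -> s1 <= 0.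
  move=> per; rewrite leNgt; apply/negP => s1_gt0.
  pose A (w : int * int) := 1 <= w.1 /\ 1 <= w.2.
  apply: (@no_escape _ _ A snd (1, 1) per) => // -[x y] [/= x1 y1].
  by rewrite /A /= pl_const pl_ge0 ?intz; nia.
move=> per.
have t1_le0 := le0 _ _ per.
have t2_le0 : t2 <= 0.
  by have [n [n0 /iter_recur_swap Tn]] := per; apply: (le0 _ t1); exists n.
apply: contrapT => tN0.
pose A (w : int * int) := w.1 < 0 /\ 0 < w.2.
apply: (@no_escape _ _ A (fun w => w.2 - w.1) (-1, 1) (periodic_iter 2 per)) => //.
move=> -[x y] [/= x0 y0].
by rewrite /A /= !pl_const (pl_ge0 _ _ (ltW y0)) pl_le0 ?intz; nia.
Qed.

(** * Orientation-preserving recurrences *)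

(** With slope at least 2 on the positive side, increments do not decrease. *)
Lemma slope_le1 t1 t2 : periodic_map (@recur int t1 t2 1 1) -> t1 <= 1.
Proof.
move=> per; rewrite leNgt; apply/negP => t1_gt1.
pose A (w : int * int) := 0 <= w.1 /\ w.1 < w.2.
apply: (@no_escape _ _ A snd (0, 1) per) => // -[x y] [/= x0 xy].
by rewrite /A /= pl_const pl_ge0 ?intz; nia.
Qed.

(** On a cone of orbits with alternating signs two steps act by a fixed matrix of
    determinant 1 and trace t1 * t2 - 2, which has infinite order once the trace
    is at least 2. *)
Lemma slopes_prod_le3 t1 t2 : periodic_map (@recur int t1 t2 1 1) ->
  t1 < 0 -> t2 < 0 -> t1 * t2 <= 3.
Proof.
move=> per t1_lt0 t2_lt0; rewrite leNgt; apply/negP => t12.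
(* The line t1 y = 2 x is the invariant direction in the parabolic case
   t1 t2 = 4; one side of it stays invariant when t1 t2 is larger. *)
pose A (w : int * int) := 0 < w.2 /\ t1 * w.2 < 2 * w.1.
apply: (@no_escape _ _ A snd (0, 1) (periodic_iter 2 per)); last first.
  by rewrite /A /=; lia.
move=> -[x y] [/= y0 xy].
rewrite /A /= !pl_const !mul1r (pl_ge0 _ _ (ltW y0)) intz.
set z := t1 * y - x.
have zy : 2 * z < t1 * y by rewrite /z; lia.
have z0 : z < 0 by nia.
rewrite pl_le0 ?intz; last exact: ltW.
have : 2 * (t2 * z) > (t1 * t2) * y by nia.
by nia.
Qed.

(** With t1 = 0 the orbit of (-p, q) reads -p, q, p, -q, - t2 q - p, and with
    t1 = 1 it reads -p, q, q + p, p, -q, - t2 q - p: either way some iterate sends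
    (-p, q) to (-q, - t2 q - p), which escapes when t2 <= -2. *)
Lemma slope_geN1 t1 t2 : periodic_map (@recur int t1 t2 1 1) ->
  0 <= t1 -> t1 <= 1 -> -1 <= t2.
Proof.
move=> per t1_ge0 t1_le1; rewrite leNgt; apply/negP => t2_lt.
pose A (w : int * int) := w.1 <= 0 /\ - w.1 < w.2.
have [t1E|t1E] : t1 = 0 \/ t1 = 1 by lia.
- subst t1; apply: (@no_escape _ _ A snd (0, 1) (periodic_iter 3 per)) => //.
  move=> -[x y] [/= x0 xy].
  rewrite /A /= !pl_const !mul1r (@pl_ge0 _ _ _ y) ?intz ?mul0r ?sub0r; last lia.
  rewrite (@pl_ge0 _ _ _ (- x)) ?intz ?mul0r ?sub0r; last lia.
  by rewrite pl_le0 ?intz; nia.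
- subst t1; apply: (@no_escape _ _ A snd (0, 1) (periodic_iter 4 per)) => //.
  move=> -[x y] [/= x0 xy].
  rewrite /A /= !pl_const !mul1r (@pl_ge0 _ _ _ y) ?intz ?mul1r; last lia.
  rewrite (@pl_ge0 _ _ _ (y - x)) ?intz ?mul1r; last lia.
  have -> : y - x - y = - x by lia.
  rewrite (@pl_ge0 _ _ _ (- x)) ?intz ?mul1r; last lia.
  by rewrite pl_le0 ?intz; nia.
Qed.

Definition finite_order_slopes : seq (int * int) :=
  [:: (1, 1); (1, 0); (1, -1); (0, 0); (0, -1); (-1, -1); (-1, -2); (-1, -3)].

(** The symmetry x |-> -x exchanges the slopes, so each obstruction applies to
    both orders of the pair. *)
Lemma recur_preserving t1 t2 : periodic_map (@recur int t1 t2 1 1) ->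
  (t1, t2) \in finite_order_slopes \/ (t2, t1) \in finite_order_slopes.
Proof.
move=> per.
have per' : periodic_map (@recur int t2 t1 1 1).
  by have [n [n0 /iter_recur_swap Tn]] := per; exists n.
have t1_le1 := slope_le1 per; have t2_le1 := slope_le1 per'.
have [t1_ge0|t1_lt0] := lerP 0 t1.
  have t2_ge := slope_geN1 per t1_ge0 t1_le1.
  have [->|->] : t1 = 0 \/ t1 = 1 by lia.
  - (have [->|[->|->]] : t2 = -1 \/ t2 = 0 \/ t2 = 1 by lia);
    first [by left | by right].
  - (have [->|[->|->]] : t2 = -1 \/ t2 = 0 \/ t2 = 1 by lia);
    first [by left | by right].
have [t2_ge0|t2_lt0] := lerP 0 t2.
  have -> : t1 = -1 by have := slope_geN1 per' t2_ge0 t2_le1; lia.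
  (have [->|->] : t2 = 0 \/ t2 = 1 by lia);
    first [by left | by right].
have prod := slopes_prod_le3 per t1_lt0 t2_lt0.
have t1_ge : -3 <= t1 by nia.
have [t1E|[t1E|t1E]] : t1 = -1 \/ t1 = -2 \/ t1 = -3 by lia.
- rewrite t1E; (have [->|[->|->]] : t2 = -1 \/ t2 = -2 \/ t2 = -3 by lia);
    by left.
- have -> : t2 = -1 by lia.
  by rewrite t1E; right.
- have -> : t2 = -1 by lia.
  by rewrite t1E; right.
Qed.

(** * The finite orders of the orientation-preserving recurrences *)

Definition cone_point (R : realDomainType) (a b : R) (u v : int * int) : R * R :=
  (a * u.1%:~R + b * v.1%:~R, a * u.2%:~R + b * v.2%:~R).

(** Zero counts as having both signs, since a piecewise linear function is linear
    on each closed half-line. *)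
Definition same_sign (m n : int) : bool :=
  (0 <= m) && (0 <= n) || (m <= 0) && (n <= 0).

Lemma recur_cone (R : realDomainType) t1 t2 d (a b : R) u v :
  0 <= a -> 0 <= b -> same_sign u.2 v.2 ->
  recur t1 t2 d d (cone_point a b u v) =
  cone_point a b (recur t1 t2 d d u) (recur t1 t2 d d v).
Proof.
move=> a0 b0 uv; rewrite /recur /cone_point /= !pl_const !intz; congr pair.
have -> : pl t1 t2 (a * u.2%:~R + b * v.2%:~R) =
    a * (pl t1 t2 u.2)%:~R + b * (pl t1 t2 v.2)%:~R :> R.
  case/orP: uv => /andP[u0 v0].
    have au : 0 <= a * u.2%:~R by rewrite mulr_ge0 ?ler0z.
    have bv : 0 <= b * v.2%:~R by rewrite mulr_ge0 ?ler0z.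
    rewrite (pl_ge0 _ _ (addr_ge0 au bv)) (pl_ge0 _ _ u0) (pl_ge0 _ _ v0).
    by rewrite !intz !intrM; ring.
  have au : a * u.2%:~R <= 0 by rewrite mulr_ge0_le0 ?lerz0.
  have bv : b * v.2%:~R <= 0 by rewrite mulr_ge0_le0 ?lerz0.
  have abuv : a * u.2%:~R + b * v.2%:~R <= 0 by rewrite -[0]addr0 lerD.
  rewrite (pl_le0 _ _ abuv) (pl_le0 _ _ u0) (pl_le0 _ _ v0).
  by rewrite !intz !intrM; ring.
by rewrite !intrB !intrM; ring.
Qed.

Lemma iter_recur_cone (R : realDomainType) t1 t2 d (a b : R) u v p :
  let T := @recur int t1 t2 d d in
  0 <= a -> 0 <= b ->
  (forall i, (i < p)%N -> same_sign (iter i T u).2 (iter i T v).2) ->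
  iter p (recur t1 t2 d d) (cone_point a b u v) =
  cone_point a b (iter p T u) (iter p T v).
Proof.
move=> T a0 b0; elim: p => [//|p IHp] uv /=.
rewrite IHp => [|i ip]; last by apply: uv; rewrite ltnW.
by rewrite recur_cone //; apply: uv.
Qed.

(** Either the orbits of u and v show that the p-th iterate is linear on the cone
    spanned by u and v and fixes it, or the cone is cut along u + v, at most k
    times. Starting from a unimodular cone, these Stern-Brocot subdivisions
    eventually reach every integral ray, in particular those where the iterate
    changes its linear expression. *)
Fixpoint fixes_cone (t1 t2 : int) (p k : nat) (u v : int * int) : bool :=
  let T := @recur int t1 t2 1 1 in
  [&& all (fun i => same_sign (iter i T u).2 (iter i T v).2) (iota 0 p),
      iter p T u == u & iter p T v == v]
  || if k is l.+1
     then fixes_cone t1 t2 p l u (u + v) && fixes_cone t1 t2 p l (u + v) v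
     else false.

Lemma fixes_coneP (R : realDomainType) t1 t2 p k u v (a b : R) :
  fixes_cone t1 t2 p k u v -> 0 <= a -> 0 <= b ->
  iter p (@recur R t1 t2 1 1) (cone_point a b u v) = cone_point a b u v.
Proof.
have linear u' v' :
    [&& all (fun i => same_sign (iter i (recur t1 t2 1 1) u').2
                                (iter i (recur t1 t2 1 1) v').2) (iota 0 p),
        iter p (recur t1 t2 1 1) u' == u' & iter p (recur t1 t2 1 1) v' == v'] ->
    forall a b : R, 0 <= a -> 0 <= b ->
    iter p (recur t1 t2 1 1) (cone_point a b u' v') = cone_point a b u' v'.
  case/and3P=> /allP uv /eqP Tu /eqP Tv a' b' a0 b0.
  by rewrite iter_recur_cone ?Tu ?Tv // => i ip; apply: uv; rewrite mem_iota.
elim: k u v a b => [|k IHk] u v a b /= /orP[/linear lin|] //; first exact: lin.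
  exact: lin.
case/andP=> /IHk uuv /IHk uvv a0 b0.
(* The larger of the two coefficients decides on which side of the ray u + v
   the point lies. *)
have [ab|ab] := lerP b a.
  have -> : cone_point a b u v = cone_point (a - b) b u (u + v).
    by rewrite /cone_point /= !intrD; congr pair; ring.
  by rewrite uuv // subr_ge0.
have -> : cone_point a b u v = cone_point a (b - a) (u + v) v.
  by rewrite /cone_point /= !intrD; congr pair; ring.
by rewrite uvv // subr_ge0 ltW.
Qed.

Definition fixes_plane t1 t2 p k : bool :=
  [&& fixes_cone t1 t2 p k (1, 0) (0, 1), fixes_cone t1 t2 p k (0, 1) (-1, 0),
      fixes_cone t1 t2 p k (-1, 0) (0, -1) & fixes_cone t1 t2 p k (0, -1) (1, 0)].

Lemma fixes_planeP (R : realDomainType) t1 t2 p k :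
  fixes_plane t1 t2 p k -> iter p (@recur R t1 t2 1 1) =1 id.
Proof.
case/and4P=> q1 q2 q3 q4 [x y].
have quad (u v : int * int) (a b : R) :
    fixes_cone t1 t2 p k u v -> 0 <= a -> 0 <= b ->
    cone_point a b u v = (x, y) -> iter p (recur t1 t2 1 1) (x, y) = (x, y).
  by move=> uv a0 b0 <-; apply: fixes_coneP uv a0 b0.
have [x0|/ltW x0] := lerP 0 x; have [y0|/ltW y0] := lerP 0 y.
- by apply: (quad _ _ x y q1) => //; rewrite /cone_point /=; congr pair; ring.
- apply: (quad _ _ (- y) x q4); rewrite ?oppr_ge0 //.
  by rewrite /cone_point /=; congr pair; ring.
- apply: (quad _ _ y (- x) q2); rewrite ?oppr_ge0 //.
  by rewrite /cone_point /=; congr pair; ring.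
- apply: (quad _ _ (- x) (- y) q3); rewrite ?oppr_ge0 //.
  by rewrite /cone_point /=; congr pair; ring.
Qed.

Lemma recur_preserving_order (R : realDomainType) t1 t2 :
  (t1, t2) \in finite_order_slopes ->
  exists2 p, iter p (@recur R t1 t2 1 1) =1 id
    & p \in [:: 3; 4; 5; 6; 7; 8; 9; 12]%N.
Proof.
(* The orders of the eight pairs are 6, 5, 9, 4, 7, 3, 8 and 12; three
   subdivisions of each quadrant suffice. *)
have /allP H : all (fun t => has (fun p => fixes_plane t.1 t.2 p 3)
    [:: 3; 4; 5; 6; 7; 8; 9; 12]%N) finite_order_slopes by vm_compute.
by move=> /H /hasP[p p_in /fixes_planeP Tp]; exists p.
Qed.

(** * Back to the plane map *)

(** Approach v along v - x e with x > 0, where the second matrix is in force. *)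
Lemma continuous_common_column (R : realType) (f : 'cV[R]_2 -> 'cV[R]_2)
    (A1 A2 : 'M[int]_2) (v : 'cV[R]_2) :
  continuous f -> piecewise_by f A1 A2 -> v 0 0 = 0 ->
  map_mx intr A1 *m v = map_mx intr A2 *m v.
Proof.
move=> f_cont [f1 f2] v0; rewrite -f1 ?v0 //.
pose e : 'cV[R]_2 := delta_mx 0 0.
have to_v (w u : 'cV[R]_2) : ((w - x *: u) @[x --> (0 : R)^'+] --> w)%classic.
  rewrite -{2}(subr0 w) -(scale0r u).
  apply: cvgB; first exact: cvg_cst.
  by apply: cvgZr_tmp; exact: cvg_at_right_filter cvg_id.
have lim1 : (f (v - x *: e) @[x --> (0 : R)^'+] --> f v)%classic.
  exact: continuous_cvg (f_cont v) (to_v v e).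
have lim2 : (f (v - x *: e) @[x --> (0 : R)^'+] --> map_mx intr A2 *m v)%classic.
  apply: cvg_trans (to_v _ (map_mx intr A2 *m e)).
  apply: near_eq_cvg; near=> x.
  rewrite f2 ?mulmxBr ?scalemxAr // !mxE v0 /= mulr1 sub0r oppr_lt0.
  by near: x; exact: nbhs_right_gt.
exact: cvg_unique lim1 lim2.
Unshelve. all: by end_near.
Qed.

Definition planar_pl (R : realDomainType) (a1 a2 b c1 c2 d : int) (w : R * R) :
    R * R :=
  (pl a1 a2 w.1 + b%:~R * w.2, pl c1 c2 w.1 + d%:~R * w.2).

(** When b = 0 the two entries on the diagonal are signs, so the second iterate is
    (x, y) |-> (x, y + e x); its n-th power translates by n e x. *)
Lemma planar_pl_fibered (R : realDomainType) a1 a2 c1 c2 d :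
  periodic_map (@planar_pl R a1 a2 0 c1 c2 d) ->
  iter 2 (@planar_pl R a1 a2 0 c1 c2 d) =1 id.
Proof.
set g := planar_pl _ _ _ _ _ _ => -[n [n0 gn]].
have [a12 a1E] : a1 = a2 /\ (a1 = 1 \/ a1 = -1).
  apply: (@periodic_pl R); exists n; split=> //.
  apply: (iter_id_surj (h := fst) (h' := fun x => (x, 0))) gn => // -[x y].
  by rewrite /= mul0r addr0.
have [_ dE] : d = d /\ (d = 1 \/ d = -1).
  apply: (@periodic_pl R); exists n; split=> //.
  apply: (iter_id_inj (h := fun y => (0, y))) gn => [y z [] //|y].
  by rewrite /g /planar_pl /= !pl0 !pl_const mul0r addr0 add0r.
subst a2.
pose e (x : R) := pl c1 c2 (a1%:~R * x) + d%:~R * pl c1 c2 x.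
have g2 x y : iter 2 g (x, y) = (x, y + e x).
  have aa : a1%:~R * a1%:~R = 1 :> R.
    by case: a1E => ->; rewrite ?mulrN1z ?mulrNN mulr1.
  have dd : d%:~R * d%:~R = 1 :> R.
    by case: dE => ->; rewrite ?mulrN1z ?mulrNN mulr1.
  rewrite /g /planar_pl /= !pl_const !mul0r !addr0 /e; congr pair.
    by rewrite mulrA aa mul1r.
  by rewrite mulrDr mulrA dd mul1r [RHS]addrC -addrA.
have g2n x y k : iter k (iter 2 g) (x, y) = (x, y + e x *+ k).
  elim: k => [|k IHk]; first by rewrite addr0.
  by rewrite iterS IHk g2 mulrSr -addrA.
case=> x y; rewrite g2.
have : iter n (iter 2 g) (x, y) = (x, y).
  by rewrite -iterM mulnC mulSn mul1n iterD !gn.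
rewrite g2n => -[/eqP]; rewrite -subr_eq0 addrAC subrr add0r mulrn_eq0 (gtn_eqF n0).
by move=> /eqP ->; rewrite addr0.
Qed.

(** Cayley-Hamilton in disguise: eliminating y from two consecutive first
    coordinates leaves the traces and the determinants. The column (b, d) must be
    common to both pieces, for the two steps may use different ones. *)
Lemma planar_pl_recur (R : realFieldType) a1 a2 b c1 c2 d (w : R * R) :
  let h (w : R * R) := (w.1, pl a1 a2 w.1 + b%:~R * w.2) in
  h (planar_pl a1 a2 b c1 c2 d w) =
  recur (a1 + d) (a2 + d) (a1 * d - b * c1) (a2 * d - b * c2) (h w).
Proof.
rewrite /= /planar_pl /recur /=; congr pair.
set z := pl a1 a2 w.1 + _.
have -> : pl (a1 + d) (a2 + d) z = pl a1 a2 z + d%:~R * z.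
  by rewrite /pl; case: ifP => _; rewrite intrD mulrDl.
have -> : pl (a1 * d - b * c1) (a2 * d - b * c2) w.1 =
    d%:~R * pl a1 a2 w.1 - b%:~R * pl c1 c2 w.1.
  by rewrite /pl; case: ifP => _; rewrite intrB !intrM; ring.
by rewrite /z; ring.
Qed.

Lemma planar_pl_order (R : realFieldType) a1 a2 b c1 c2 d :
  periodic_map (@planar_pl R a1 a2 b c1 c2 d) ->
  exists2 p, iter p (@planar_pl R a1 a2 b c1 c2 d) =1 id
    & p \in [:: 2; 3; 4; 5; 6; 7; 8; 9; 12]%N.
Proof.
have [-> /planar_pl_fibered|b0] := eqVneq b 0; first by exists 2%N.
have bR : b%:~R != 0 :> R by rewrite intr_eq0.
move=> [n [n0 gn]].
pose h (w : R * R) := (w.1, pl a1 a2 w.1 + b%:~R * w.2).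
pose h' (w : R * R) := (w.1, (w.2 - pl a1 a2 w.1) / b%:~R).
have hK : cancel h h'.
  by case=> x y; rewrite /h /h' /= [pl _ _ _ + _]addrC addrK mulrC mulKf.
have h'K : cancel h' h.
  by case=> x y; rewrite /h /h' /= mulrC divfK // addrC subrK.
have h_conj := @planar_pl_recur R a1 a2 b c1 c2 d.
have Tn := iter_id_surj h'K h_conj gn.
suff [p Tp p_in] : exists2 p,
    iter p (@recur R (a1 + d) (a2 + d) (a1 * d - b * c1) (a2 * d - b * c2)) =1 id
    & p \in [:: 2; 3; 4; 5; 6; 7; 8; 9; 12]%N.
  by exists p => //; apply: iter_id_inj (can_inj hK) h_conj Tp.
have perZ : periodic_map
    (@recur int (a1 + d) (a2 + d) (a1 * d - b * c1) (a2 * d - b * c2)).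
  by apply: (@periodic_recur_int R); exists n.
have [dets det1] := recur_det_unit perZ; move: perZ; rewrite -dets.
case: det1 => -> perZ.
- have [] := recur_preserving perZ => /(recur_preserving_order R)[p Tp p_in].
    by exists p => //; rewrite inE p_in orbT.
  by exists p; [exact: iter_recur_swap | rewrite inE p_in orbT].
- have [-> ->] := recur_reversing perZ.
  exists 2%N => // -[x y].
  by rewrite /recur /= !pl_const !mul0r mulrN1z !mulN1r !sub0r !opprK.
Qed.

Lemma mul_map_intr_cV2 (R : realType) (A : 'M[int]_2) (v : 'cV[R]_2) i :
  (map_mx intr A *m v) i 0 = (A i 0)%:~R * v 0 0 + (A i 1)%:~R * v 1 0.
Proof.
rewrite mxE !big_ord_recl big_ord0 addr0 !mxE.
by have -> : lift ord0 ord0 = 1 :> 'I_2 by apply/val_inj.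
Qed.

Lemma piecewise_planar_pl (R : realType) (f : 'cV[R]_2 -> 'cV[R]_2) A1 A2
    (v : 'cV[R]_2) :
  continuous f -> piecewise_by f A1 A2 ->
  (f v 0 0, f v 1 0) =
  planar_pl (A1 0 0) (A2 0 0) (A1 0 1) (A1 1 0) (A2 1 0) (A1 1 1) (v 0 0, v 1 0).
Proof.
move=> f_cont f_pw.
have col2 i : A1 i 1 = A2 i 1.
  have /(congr1 (fun u : 'cV[R]_2 => u i 0)) :=
    @continuous_common_column R f A1 A2 (delta_mx 1 0) f_cont f_pw (mxE _ _ _ _).
  by rewrite !mul_map_intr_cV2 !mxE /= !mulr0 !mulr1 !add0r => /intr_inj.
case: f_pw => f1 f2; rewrite /planar_pl /pl /=.
by case: lerP => [/f1|/f2] ->; rewrite !mul_map_intr_cV2 -?col2.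
Qed.

Theorem theorem1 (R : realType) (f : 'cV[R]_2 -> 'cV[R]_2)
    (f_cont : continuous f) (f_per : periodic_map f)
    (f_pw : exists A1 A2 : 'M[int]_2, piecewise_by f A1 A2) :
  exists p : nat,
    is_least_period f p /\ p \in [:: 1; 2; 3; 4; 5; 6; 7; 8; 9; 12]%N.
Proof.
case: f_pw => A1 [A2 f_pw].
pose h (v : 'cV[R]_2) := (v 0 0, v 1 0).
pose h' (w : R * R) : 'cV[R]_2 := \col_i (if i == 0 then w.1 else w.2).
have h'K : cancel h' h by case=> x y; rewrite /h /h' !mxE.
have h_inj : injective h.
  move=> u v [uv0 uv1]; apply/matrixP => i j; rewrite ord1.
  case: (unliftP 0 i) => [k ->|-> //].
  by rewrite [k]ord1 (_ : lift 0 0 = 1) //; apply/val_inj.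
have h_conj v := piecewise_planar_pl v f_cont f_pw.
have [n [n0 fn]] := f_per.
have [|P gP PL] := @planar_pl_order R
  (A1 0 0) (A2 0 0) (A1 0 1) (A1 1 0) (A2 1 0) (A1 1 1).
  by exists n; split=> //; apply: iter_id_surj h'K h_conj fn.
have fP : iter P f =1 id := iter_id_inj h_inj h_conj gP.
have P0 : (0 < P)%N by case: (P) PL.
have [p [pf pP]] := least_period_dvd P0 fP; exists p; split=> //.
have /allP/(_ _ PL)/allP : all (fun m => all
    (mem [:: 1; 2; 3; 4; 5; 6; 7; 8; 9; 12]%N) (divisors m))
  [:: 2; 3; 4; 5; 6; 7; 8; 9; 12]%N by [].
by apply; rewrite -dvdn_divisors.
Qed.
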